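(* Let $A$ be a $PMV_f$-chain. Then $A^\sharp$ is a totally ordered semi-low $l_u$-ring.
   Context: An MV-algebra is $(A,\oplus,\neg,0)$ with $(A,\oplus,0)$ a commutative monoid, $\neg\neg x=x$, $x\oplus\neg 0=\neg 0$, $\neg(\neg x\oplus y)\oplus y=\neg(\neg y\oplus x)\oplus x$. Put $u=\neg 0$, $x\odot y=\neg(\neg x\oplus\neg y)$, $x\ominus y=\neg(\neg x\oplus y)$; the lattice order is $x\le y\iff x\ominus y=0$. A $PMV_f$-algebra is an MV-algebra with an associative commutative product $\cdot$ such that for all $a,b,c$: $a0=0$; $a(b\oplus c)\le ab\oplus ac$; $ab\le a\wedge b$; $a(b\ominus c)=ab\ominus ac$. A $PMV_f$-chain is a totally ordered $PMV_f$-algebra. All rings are commutative and associative (not necessarily with a multiplicative identity). An $l_u$-ring $(R,\mathbf u)$ is a ring whose additive group is a lattice-ordered abelian group, in which $x,y\ge0$ implies $xy\ge 0$, with a strong unit $\mathbf u\ge 0$: for each $x\in R$ there is an integer $n\ge0$ with $|x|\le n\mathbf u$. It is semi-low if $ab\le a\wedge b$ for all $a,b\in[0,\mathbf u]$. For a $PMV_f$-chain $A$, $A^\sharp$ has as underlying ordered group Chang's group $A^*$: the set $\mathbb Z\times A$ with the identification $(m+1,0)=(m,u)$, addition $(m,a)+(n,b)=(m+n,a\oplus b)$ if $a\oplus b\ne u$ and $(m,a)+(n,b)=(m+n+1,a\odot b)$ if $a\oplus b=u$, negatives $-(m,a)=(-m-1,\neg a)$, order $(m,a)\le(n,b)$ iff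 $m<n$ or ($m=n$ and $a\le b$) (on representatives with second entry $\neq u$), and strong unit $\mathbf u=(1,0)=(0,u)$. By a result of Chang, $A^*$ is a totally ordered abelian group with strong unit $\mathbf u$. The product on $A^\sharp$ is $$(m,a)\cdot(n,b)=mn(0,u^2)+m(0,bu)+n(0,au)+(0,ab),$$ where $k(0,x)$ denotes the $k$-fold integer multiple in $A^*$. *)

(* Defs.v *)
From HB Require Import structures.
From mathcomp Require Import all_boot all_order all_algebra generic_quotient ring.
From mathcomp Require Import boolp.
From Stdlib Require Import Relation_Operators.

Set Implicit Arguments.
Unset Strict Implicit.
Unset Printing Implicit Defensive.

Import Order.TTheory GRing.Theory Num.Theory.

Declare Scope mv_scope.
Delimit Scope mv_scope with MV.
Local Open Scope order_scope.
Local Open Scope mv_scope.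

(* MV-algebras over an Order.Lattice: the axiom [mvleE] forces the library    *)
(* order to be the MV order, which then determines meet and join. This is no  *)
(* restriction: the factory [isMV] below derives the lattice from the         *)
(* equational axioms alone.                                                   *)
HB.mixin Record Lattice_isMV d A of Order.Lattice d A := {
  mv0 : A;
  oplus : A -> A -> A;
  mvneg : A -> A;
  oplusA : associative oplus;
  oplusC : commutative oplus;
  oplus0 : right_id mv0 oplus;
  mvnegK : involutive mvneg;
  oplus_neg0 : forall x, oplus x (mvneg mv0) = mvneg mv0;
  mv_luk : forall x y, oplus (mvneg (oplus (mvneg x) y)) y
                     = oplus (mvneg (oplus (mvneg y) x)) x;
  mvleE : forall x y, (x <= y) = (mvneg (oplus (mvneg x) y) == mv0)
}.

#[short(type="mvType")]
HB.structure Definition MV d := {A of Lattice_isMV d A & Order.Lattice d A}.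

#[short(type="mvChainType")]
HB.structure Definition MVChain d := {A of MV d A & Order.Total d A}.

Notation "x ⊕ y" := (oplus x y) (at level 50, left associativity) : mv_scope.
Notation "¬ x" := (mvneg x) (at level 35, right associativity) : mv_scope.

Definition mvu {d} {A : mvType d} : A := ¬ mv0.
Definition odot {d} {A : mvType d} (x y : A) := ¬ (¬ x ⊕ ¬ y).
Definition ominus {d} {A : mvType d} (x y : A) := ¬ (¬ x ⊕ y).

Notation "x ⊙ y" := (odot x y) (at level 40, left associativity) : mv_scope.
Notation "x ⊖ y" := (ominus x y) (at level 50, left associativity) : mv_scope.

HB.factory Record isMV (d : Order.disp_t) A of Choice A := {
  mv0 : A;
  oplus : A -> A -> A;
  mvneg : A -> A;
  oplusA : associative oplus;
  oplusC : commutative oplus;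
  oplus0 : right_id mv0 oplus;
  mvnegK : involutive mvneg;
  oplus_neg0 : forall x, oplus x (mvneg mv0) = mvneg mv0;
  mv_luk : forall x y, oplus (mvneg (oplus (mvneg x) y)) y
                     = oplus (mvneg (oplus (mvneg y) x)) x
}.

HB.builders Context d A of isMV d A.

Let le (x y : A) := mvneg (oplus (mvneg x) y) == mv0.
Let join x y := oplus (mvneg (oplus (mvneg x) y)) y.
Let meet x y := mvneg (join (mvneg x) (mvneg y)).

Let leE x y : le x y = (oplus (mvneg x) y == mvneg mv0).
Proof. by rewrite /le -(inj_eq (can_inj mvnegK)) mvnegK. Qed.

Let oplus0l x : oplus mv0 x = x.
Proof. by rewrite oplusC oplus0. Qed.

Let oplusN x : oplus x (mvneg x) = mvneg mv0.
Proof.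
have := mv_luk x (mvneg mv0); rewrite mvnegK !oplus_neg0 oplus0l.
by rewrite oplusC => <-.
Qed.

Let leP x y : reflect (exists z, y = oplus x z) (le x y).
Proof.
rewrite leE; apply: (iffP eqP) => [xy | [z ->]].
  exists (mvneg (oplus (mvneg y) x)).
  by rewrite oplusC -mv_luk xy mvnegK oplus0l.
by rewrite oplusA (oplusC _ x) oplusN oplusC oplus_neg0.
Qed.

Let le_refl : reflexive le.
Proof. by move=> x; apply/leP; exists mv0; rewrite oplus0. Qed.

Let le_anti : antisymmetric le.
Proof.
move=> x y /andP[]; rewrite !leE => /eqP xy /eqP yx.
by have := mv_luk x y; rewrite xy yx mvnegK !oplus0l.
Qed.

Let le_trans : transitive le.
Proof.
move=> y x z /leP[v ->] /leP[w ->]; apply/leP; exists (oplus v w).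
by rewrite oplusA.
Qed.

Let leN x y : le (mvneg x) (mvneg y) = le y x.
Proof. by rewrite !leE mvnegK oplusC. Qed.

Let leD2 x y z : le x y -> le (oplus x z) (oplus y z).
Proof.
by case/leP=> w ->; apply/leP; exists w; rewrite -!oplusA (oplusC z).
Qed.

Let joinC x y : join x y = join y x.
Proof. exact: mv_luk. Qed.

Let le_joinr x y : le y (join x y).
Proof. by apply/leP; exists (mvneg (oplus (mvneg x) y)); rewrite oplusC. Qed.

Let joinP x y z : le (join x y) z = le x z && le y z.
Proof.
apply/idP/andP => [h | [xz yz]].
  by split; apply: le_trans h; rewrite ?le_joinr // joinC le_joinr.
have -> : z = join z y.
  by rewrite joinC /join; move: yz; rewrite leE => /eqP ->; rewrite mvnegK oplus0l.
by apply: leD2; rewrite leN; apply: leD2; rewrite leN.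
Qed.

Let meetP x y z : le x (meet y z) = le x y && le x z.
Proof. by rewrite -[x in LHS]mvnegK leN joinP !leN. Qed.

HB.instance Definition _ := Order.Le_isPOrder.Build d A le_refl le_anti le_trans.
HB.instance Definition _ := Order.POrder_MeetJoin_isLattice.Build d A meetP joinP.
HB.instance Definition _ := Lattice_isMV.Build d A oplusA oplusC oplus0 mvnegK
  oplus_neg0 mv_luk (fun _ _ => erefl).

HB.end.

HB.mixin Record MV_isPMVf d A of MV d A := {
  pmul : A -> A -> A;
  pmulA : associative pmul;
  pmulC : commutative pmul;
  pmulx0 : right_zero (mv0 : A) pmul;
  pmul_oplus : forall a b c, pmul a (b ⊕ c) <= pmul a b ⊕ pmul a c;
  pmul_le : forall a b, pmul a b <= Order.meet a b;
  pmul_ominus : forall a b c : A, pmul a (b ⊖ c) = pmul a b ⊖ pmul a c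
}.

#[short(type="pmvfType")]
HB.structure Definition PMVf d := {A of MV_isPMVf d A & MV d A}.

#[short(type="pmvfChainType")]
HB.structure Definition PMVfChain d := {A of PMVf d A & Order.Total d A}.


Section LURing.
Local Open Scope ring_scope.

(* The library has neither rings without identity nor lattice-ordered groups: *)
(* the product, meet and join are explicit arguments over an ordered additive *)
(* group.                                                                     *)
Variables (R : porderZmodType) (meet join mul : R -> R -> R) (u : R).

Record is_lu_ring : Prop := IsLURing {
  lu_leD2r : forall x y z : R, x <= y -> x + z <= y + z;
  lu_meetP : forall x y z : R, (z <= meet x y) = (z <= x) && (z <= y);
  lu_joinP : forall x y z : R, (join x y <= z) = (x <= z) && (y <= z);
  lu_mulA : associative mul;
  lu_mulC : commutative mul;
  lu_mulDr : right_distributive mul +%R;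
  lu_mul_ge0 : forall x y : R, 0 <= x -> 0 <= y -> 0 <= mul x y;
  lu_unit_ge0 : 0 <= u;
  lu_strong_unit : forall x : R, exists n : nat, join x (- x) <= u *+ n
}.

Definition semi_low : Prop := forall a b : R,
  0 <= a <= u -> 0 <= b <= u -> mul a b <= meet a b.

End LURing.

Section MVTheory.
Context {d : Order.disp_t} {A : mvType d}.
Implicit Types x y z : A.

Lemma oplus0l x : mv0 ⊕ x = x.
Proof. by rewrite oplusC oplus0. Qed.

Lemma oplusu x : x ⊕ mvu = mvu. Proof. exact: oplus_neg0. Qed.

Lemma oplusul x : mvu ⊕ x = mvu. Proof. by rewrite oplusC oplusu. Qed.

Lemma mvleEu x y : (x <= y) = (¬ x ⊕ y == mvu).
Proof. by rewrite mvleE -(inj_eq (can_inj mvnegK)) mvnegK. Qed.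

Lemma mvnegu : ¬ (mvu : A) = mv0. Proof. exact: mvnegK. Qed.

Lemma odotC x y : x ⊙ y = y ⊙ x.
Proof. by rewrite /odot oplusC. Qed.

Lemma odotA x y z : x ⊙ (y ⊙ z) = x ⊙ y ⊙ z.
Proof. by rewrite /odot !mvnegK oplusA. Qed.

Lemma odotul x : mvu ⊙ x = x.
Proof. by rewrite /odot mvnegu oplus0l mvnegK. Qed.

Lemma odotu x : x ⊙ mvu = x. Proof. by rewrite odotC odotul. Qed.

Lemma odot0l x : mv0 ⊙ x = mv0.
Proof. by rewrite /odot oplusul mvnegu. Qed.

Lemma odotN x : x ⊙ ¬ x = mv0.
Proof.
apply/eqP; rewrite /odot -(inj_eq (can_inj mvnegK)) !mvnegK.
by have := lexx x; rewrite mvleEu.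
Qed.

Lemma oplusN x : x ⊕ ¬ x = mvu.
Proof. by have := lexx x; rewrite mvleEu oplusC => /eqP. Qed.

Lemma mvle0 x : mv0 <= x. Proof. by rewrite mvleEu oplusul. Qed.

Lemma mvleu x : x <= mvu. Proof. by rewrite mvleEu oplusu. Qed.

Lemma odot_eq0 x y : (x ⊙ y == mv0) = (x <= ¬ y).
Proof. by rewrite mvleEu /odot -[LHS](inj_eq (can_inj mvnegK)) mvnegK. Qed.

Lemma mvleN x y : (¬ x <= ¬ y) = (y <= x).
Proof. by rewrite !mvleEu mvnegK oplusC. Qed.

Lemma oplus_equ x y : (x ⊕ y == mvu) = (¬ x <= y).
Proof. by rewrite mvleEu mvnegK. Qed.

Lemma mvmeetC x y : y ⊙ (¬ y ⊕ x) = x ⊙ (¬ x ⊕ y).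
Proof.
rewrite /odot; congr (¬ _); have := mv_luk (¬ x) (¬ y).
by rewrite !mvnegK (oplusC x) (oplusC y) oplusC [in RHS]oplusC.
Qed.

Lemma odot_le x y : x <= y -> y ⊙ (¬ y ⊕ x) = x.
Proof. by rewrite mvmeetC mvleEu => /eqP ->; rewrite odotu. Qed.

Lemma oplus_le x y : x <= y -> x ⊕ (y ⊙ ¬ x) = y.
Proof.
rewrite mvleEu => /eqP xy; have := mv_luk x y; rewrite xy mvnegu oplus0l => E.
by rewrite [RHS]E oplusC /odot mvnegK.
Qed.

Lemma oplus_odotA x y z : x ⊙ y = mv0 -> y ⊙ z = mv0 ->
  (x ⊕ y) ⊙ z = x ⊙ (y ⊕ z).
Proof.
move=> xy yz.
have {}xy : x <= ¬ y by rewrite -odot_eq0 xy.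
have {}yz : z <= ¬ y by rewrite -odot_eq0 odotC yz.
rewrite -{1}(odot_le yz) -[in RHS](odot_le xy) mvnegK odotA (oplusC x).
by rewrite (odotC (y ⊕ x)).
Qed.

Lemma odot_leL x y : x ⊙ y <= x.
Proof.
rewrite mvleEu /odot mvnegK -oplusA (oplusC _ x) oplusA.
by rewrite (oplusC _ x) oplusN oplusul.
Qed.

Lemma odot_equ x y : x ⊙ y = mvu -> x = mvu.
Proof. by move=> xy; apply/le_anti; rewrite mvleu -xy odot_leL. Qed.

Lemma odot_oplusA x y z : x ⊕ y = mvu -> y ⊕ z = mvu ->
  x ⊙ y ⊕ z = x ⊕ y ⊙ z.
Proof.
move=> xy yz; apply: (can_inj mvnegK).
have E v w : ¬ (v ⊕ w) = ¬ v ⊙ ¬ w by rewrite /odot !mvnegK.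
have E' v w : ¬ (v ⊙ w) = ¬ v ⊕ ¬ w by rewrite /odot !mvnegK.
by rewrite !E !E' oplus_odotA // -E ?xy ?yz mvnegu.
Qed.

Lemma odot_oplus_mixA x y z : x ⊕ y = mvu -> y ⊙ z = mv0 ->
  x ⊙ y ⊕ z = x ⊙ (y ⊕ z).
Proof.
move=> xy yz.
have nxy : ¬ x <= y by rewrite -oplus_equ xy.
have yE := oplus_le nxy; rewrite mvnegK in yE.
rewrite -[in RHS]yE -oplusA odot_le ?(odotC x) //.
have -> : x = ¬ ¬ x by rewrite mvnegK.
rewrite -odot_eq0 oplusC oplus_odotA ?mvnegK.
- by rewrite (oplusC (y ⊙ x)) yE odotC yz.
- by rewrite odotA (odotC z) yz odot0l.
- by rewrite -odotA odotN odotC odot0l.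
Qed.

End MVTheory.

(* Chang's group: [int * A] modulo the equivalence relation generated by      *)
(* (m + 1, 0) ~ (m, u). When [A] is trivial this is the trivial group.        *)
Section ChangQuotient.
Local Open Scope ring_scope.
Local Open Scope mv_scope.
Context {d : Order.disp_t} (A : mvChainType d).
Implicit Types p q : int * A.

Definition chang_ident p q : Prop :=
  exists m : int, p = (m + 1, mv0) /\ q = (m, mvu).

Definition chang_eqv : rel (int * A) :=
  fun p q => `[< clos_refl_sym_trans _ chang_ident p q >].

Lemma chang_eqv_refl : reflexive chang_eqv.
Proof. by move=> p; apply/asboolP; apply: rst_refl. Qed.

Lemma chang_eqv_sym : symmetric chang_eqv.
Proof. by move=> p q; apply/asboolP/asboolP; apply: rst_sym. Qed.

Lemma chang_eqv_trans : transitive chang_eqv.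
Proof.
by move=> q p r /asboolP pq /asboolP qr; apply/asboolP; apply: rst_trans pq qr.
Qed.

Canonical chang_equiv :=
  EquivRel chang_eqv chang_eqv_refl chang_eqv_sym chang_eqv_trans.

Definition chang := {eq_quot chang_equiv}%qT.

HB.instance Definition _ := Choice.on chang.
HB.instance Definition _ := EqQuotient.on chang.

End ChangQuotient.

Section ChangGroup.
Local Open Scope ring_scope.
Local Open Scope quotient_scope.
Local Open Scope mv_scope.
Context {d : Order.disp_t} {A : mvChainType d}.
Implicit Types (p q r : int * A) (m n k : int) (a b c : A).

Definition cls p : chang A := \pi p.

Lemma cls_ident m : cls (m + 1, mv0) = cls (m, mvu).
Proof. by apply/eqmodP/asboolP; apply: rst_step; exists m. Qed.

Lemma cls_ind (P : chang A -> Prop) : (forall p, P (cls p)) -> forall x, P x.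
Proof. by move=> H x; rewrite -[x]reprK; apply: H. Qed.

Lemma cls_lift (T : Type) (f : int * A -> T) :
  (forall m, f (m + 1, mv0) = f (m, mvu)) ->
  forall p q, cls p = cls q -> f p = f q.
Proof.
move=> fE p q /eqmodP /asboolP; elim=> {p q} //.
- by move=> _ _ [m [-> ->]].
- by move=> p q r _ -> _ ->.
Qed.

Lemma repr_lift (T : Type) (f : int * A -> T) :
  (forall m, f (m + 1, mv0) = f (m, mvu)) ->
  forall p, f (repr (cls p)) = f p.
Proof. by move=> fE p; apply: cls_lift fE _ _ _; apply: reprK. Qed.

(* The formulas below respect the identification: see [chang_addE],           *)
(* [chang_oppE] and [sharp_mulE].                                             *)
Definition pair_add p q : int * A :=
  if p.2 ⊕ q.2 != mvu then (p.1 + q.1, p.2 ⊕ q.2)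
  else (p.1 + q.1 + 1, p.2 ⊙ q.2).

Definition pair_opp p : int * A := (- p.1 - 1, ¬ p.2).

Definition chang_add (x y : chang A) := cls (pair_add (repr x) (repr y)).
Definition chang_opp (x : chang A) := cls (pair_opp (repr x)).
Definition chang_zero := cls (0, mv0).

Lemma pair_addC : commutative pair_add.
Proof.
by move=> p q; rewrite /pair_add oplusC odotC (addrC p.1).
Qed.

Lemma pair_add_ident q m :
  cls (pair_add (m + 1, mv0) q) = cls (pair_add (m, mvu) q).
Proof.
case: q => n b; rewrite /pair_add /= oplus0l oplusul eqxx /= odotul odot0l.
case: eqP => [->|_] /=; last by rewrite addrAC.
by rewrite cls_ident addrAC.
Qed.

Lemma chang_addE p q : chang_add (cls p) (cls q) = cls (pair_add p q).
Proof.
rewrite /chang_add (repr_lift (f := fun p => cls (pair_add p _))); last first.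
  exact: pair_add_ident.
by rewrite (repr_lift (f := fun q => cls (pair_add p q))) // => m;
  rewrite ![pair_add p _]pair_addC pair_add_ident.
Qed.

Lemma chang_oppE p : chang_opp (cls p) = cls (pair_opp p).
Proof.
apply: (repr_lift (f := fun p => cls (pair_opp p))) => m.
by rewrite /pair_opp /= mvnegu -cls_ident subrK opprD.
Qed.

Lemma chang_addC : commutative chang_add.
Proof. by move=> x y; rewrite /chang_add pair_addC. Qed.

Lemma chang_add0 : left_id chang_zero chang_add.
Proof.
elim/cls_ind=> -[m a]; rewrite chang_addE /pair_add /= oplus0l odot0l add0r.
by case: eqP => [->|//]; rewrite cls_ident.
Qed.

Lemma chang_addN : left_inverse chang_zero chang_opp chang_add.
Proof.
elim/cls_ind=> -[m a]; rewrite chang_oppE chang_addE /pair_add /=.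
rewrite oplusC oplusN eqxx /= odotC odotN; congr (cls (_, _)).
by rewrite addrAC subrK addNr.
Qed.

Lemma chang_addA : associative chang_add.
Proof.
elim/cls_ind=> -[m a]; elim/cls_ind=> -[n b]; elim/cls_ind=> -[k c].
have eq0 x y : x ⊕ y != mvu -> x ⊙ y = mv0 :> A.
  rewrite oplus_equ => xy; apply/eqP; rewrite odot_eq0 -mvleN mvnegK.
  by case/orP: (le_total (¬ x) y) => //; rewrite (negPf xy).
rewrite !chang_addE /pair_add /=.
case: (eqVneq (b ⊕ c) mvu) => bc; case: (eqVneq (a ⊕ b) mvu) => ab /=.
- rewrite odot_oplusA // odotA; case: eqP => _ /=; congr (cls (_, _)); ring.
- rewrite -oplusA bc oplusu eqxx /=.
  have E : c ⊙ b ⊕ a = c ⊙ (b ⊕ a).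
    by apply: odot_oplus_mixA; [rewrite oplusC | rewrite odotC eq0].
  have -> : a ⊕ b ⊙ c = (a ⊕ b) ⊙ c.
    by rewrite oplusC (odotC b) E odotC (oplusC b).
  case: eqP => [abc|_] /=; last by congr (cls (_, _)); ring.
  by rewrite (odot_equ abc) eqxx in ab.
- rewrite odot_oplus_mixA ?(eq0 b c) // oplusA ab oplusul eqxx /=.
  case: eqP => [abc|_] /=; last by congr (cls (_, _)); ring.
  by rewrite odotC in abc; rewrite (odot_equ abc) eqxx in bc.
- rewrite oplusA; case: eqP => _ /=; rewrite ?oplus_odotA ?(eq0 a b) ?(eq0 b c) //;
    congr (cls (_, _)); ring.
Qed.

HB.instance Definition _ := GRing.isZmodule.Build (chang A)
  chang_addA chang_addC chang_add0 chang_addN.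

Lemma cls_add p q : cls p + cls q = cls (pair_add p q).
Proof. exact: chang_addE. Qed.

Lemma cls_opp p : - cls p = cls (pair_opp p).
Proof. exact: chang_oppE. Qed.

(* The order refers to representatives whose second entry is not [mvu]; they  *)
(* exist unless [A] is trivial, in which case [chang A] has a single element. *)
Definition chang_le (x y : chang A) : bool :=
  `[< forall m n a b, a <> mvu -> b <> mvu ->
      x = cls (m, a) -> y = cls (n, b) ->
      (m < n)%R \/ m = n /\ (a <= b)%O >].

Let nf p : int * A := if p.2 == mvu then (p.1 + 1, mv0) else p.

Lemma mv_nontriv a : a <> mvu -> (mv0 : A) <> mvu.
Proof. by move=> au uE; apply: au; rewrite -[a]oplus0 uE oplusu. Qed.

Let nfE : (mv0 : A) <> mvu -> forall p q, cls p = cls q -> nf p = nf q.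
Proof.
by move=> /eqP/negPf nt; apply: cls_lift => m; rewrite /nf /= eqxx nt.
Qed.

Lemma cls_inj m n a b : a <> mvu -> b <> mvu -> cls (m, a) = cls (n, b) ->
  m = n /\ a = b.
Proof.
move=> au bu /(nfE (mv_nontriv au)); rewrite /nf /=.
by move/eqP/negPf: au => ->; move/eqP/negPf: bu => -> [].
Qed.

Lemma clsP : (mv0 : A) <> mvu ->
  forall x : chang A, exists m a, a <> mvu /\ x = cls (m, a).
Proof.
move=> nt; elim/cls_ind=> -[m a]; case: (eqVneq a mvu) => [->|/eqP au].
  by exists (m + 1), mv0; rewrite cls_ident.
by exists m, a.
Qed.

Lemma cls_triv : (mv0 : A) = mvu -> forall x : chang A, x = chang_zero.
Proof.
move=> uE; have a0 a : a = mv0 by apply/le_anti; rewrite mvle0 uE mvleu.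
have S m : cls (m + 1, mv0) = cls (m, mv0) by rewrite cls_ident -uE.
elim/cls_ind=> -[m a]; rewrite (a0 a) => {a}; elim/int_rec: m => // n.
  by rewrite -addn1 PoszD S.
  by move=> <-; rewrite -[LHS]S -addn1 PoszD opprD subrK.
Qed.

Lemma chang_leE m n a b : a <> mvu -> b <> mvu ->
  reflect ((m < n)%R \/ m = n /\ (a <= b)%O)
          (chang_le (cls (m, a)) (cls (n, b))).
Proof.
move=> au bu; rewrite /chang_le.
apply: (iffP (asboolP _)) => [|H m' n' a' b' au' bu']; first exact.
by move=> /cls_inj[]// <- <- /cls_inj[]// <- <-.
Qed.

Lemma chang_le_refl : reflexive chang_le.
Proof.
move=> x; apply/asboolP=> m n a b au bu -> /cls_inj[]// -> ->; right.
by rewrite lexx.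
Qed.

Lemma chang_le_anti : antisymmetric chang_le.
Proof.
move=> x y /andP[]; case: (pselect ((mv0 : A) = mvu)) => [tr|nt].
  by rewrite (cls_triv tr x) (cls_triv tr y).
have [m [a [au ->]]] := clsP nt x; have [n [b [bu ->]]] := clsP nt y.
move=> /(chang_leE _ _ au bu)[mn|[mn ab]] /(chang_leE _ _ bu au)[nm|[nm ba]].
- by have := lt_trans mn nm; rewrite ltxx.
- by rewrite nm ltxx in mn.
- by rewrite mn ltxx in nm.
- by rewrite mn; congr (cls (_, _)); apply/le_anti; rewrite ab.
Qed.

Lemma chang_le_trans : transitive chang_le.
Proof.
move=> y x z; case: (pselect ((mv0 : A) = mvu)) => [tr|nt].
  by rewrite (cls_triv tr x) (cls_triv tr y).
have [m [a [au ->]]] := clsP nt x; have [n [b [bu ->]]] := clsP nt y.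
have [k [c [cu ->]]] := clsP nt z.
move=> /(chang_leE _ _ au bu)[mn|[-> ab]] /(chang_leE _ _ bu cu)[nk|[<- bc]];
  apply/(chang_leE _ _ au cu); [left|by left|by left|right].
- exact: lt_trans nk.
- by split=> //; apply: le_trans bc.
Qed.

HB.instance Definition _ := Order.Le_isPOrder.Build ring_display (chang A)
  chang_le_refl chang_le_anti chang_le_trans.

Lemma cls_le m n a b : a <> mvu -> b <> mvu ->
  reflect ((m < n)%R \/ m = n /\ (a <= b)%O)
          ((cls (m, a) <= cls (n, b))%R).
Proof. exact: chang_leE. Qed.

End ChangGroup.

Section Sharp.
Local Open Scope ring_scope.
Local Open Scope mv_scope.
Context {d : Order.disp_t} {A : pmvfChainType d}.

Local Notation emb a := (cls (0, a)).

Definition sharp_unit : chang A := cls (1, mv0).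

Definition pair_mul (p q : int * A) : chang A :=
  emb (pmul mvu mvu) *~ (p.1 * q.1) + emb (pmul q.2 mvu) *~ p.1
  + emb (pmul p.2 mvu) *~ q.1 + emb (pmul p.2 q.2).

Definition sharp_mul (x y : chang A) : chang A := pair_mul (repr x) (repr y).

Lemma sharp_unitE : sharp_unit = emb mvu.
Proof. by rewrite -cls_ident add0r. Qed.

Lemma pair_mulC : commutative pair_mul.
Proof.
move=> [m a] [n b]; rewrite /pair_mul /= (mulrC n m) (pmulC a b).
by congr (_ + _); rewrite addrAC.
Qed.

Lemma pair_mul_ident q m : pair_mul (m + 1, mv0) q = pair_mul (m, mvu) q.
Proof.
case: q => n b; rewrite /pair_mul /= ![pmul mv0 _]pmulC !pmulx0.
have z : emb (mv0 : A) = 0 by [].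
rewrite z mul0rz !addr0 mulrDl mul1r !mulrzDr (pmulC mvu b) !addrA.
by congr (_ + _); rewrite -!addrA; congr (_ + _); rewrite addrC.
Qed.

Lemma sharp_mulE p q : sharp_mul (cls p) (cls q) = pair_mul p q.
Proof.
rewrite /sharp_mul (repr_lift (f := fun p => pair_mul p _)); last first.
  exact: pair_mul_ident.
by rewrite (repr_lift (f := pair_mul p)) // => m;
  rewrite ![pair_mul p _]pair_mulC pair_mul_ident.
Qed.

End Sharp.

Arguments sharp_unit {d} A.
Arguments sharp_mul {d} A.

(* Main.v *)
Require Import Defs.
From HB Require Import structures.
From mathcomp Require Import all_boot all_order all_algebra.
From mathcomp Require Import zify boolp.

(** Write [emb a] for the class of [(0, a)] and [u] for [emb mvu].  Every element
    of Chang's group is [(m, a) = m u + emb a], so the group is generated by the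
    [emb a], and its positive cone is generated by them as a monoid.  Hence
    everything follows once the product of the statement is known to be the
    biadditive extension of [emb a * emb b = emb (a b)].

    Biadditivity rests on the single axiom [a (b ⊖ c) = a b ⊖ a c].  It makes
    multiplication by [c] monotone, and since [emb (a ⊖ b) = emb a - emb b]
    whenever [b <= a], it says that multiplication by [c] preserves genuine
    differences of the group ([emb_pmul_ominus]).  A sum in Chang's group either
    stays below [u] or is carried, with remainder [a ⊙ b = a ⊖ ¬ b]; either way it
    can be rewritten with such differences, so [y |-> emb c * y] is additive
    ([sharp_mul_embDr]).  The product formula is [(m, a) * y = m (u * y) + emb a * y]
    ([sharp_mul_cls]), which gives additivity in general.

    Associativity then only has to be compared on generators, where it is that of
    [A]; a product of positive elements is a sum of elements [emb (a b)]; and the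
    interval [[0, u]] consists of the [emb a], so that semi-lowness is the axiom
    [a b <= a ∧ b].  The order part (totality, translation invariance, strong unit)
    concerns Chang's group alone and is proved by comparing integer parts first.
    The order is described through representatives with second entry different from
    [u], which do not exist when [A] is trivial; the lemmas [cls_le_fst],
    [cls_le_snd] and [le_reps] give a description by arbitrary representatives,
    valid in all cases. *)

Set Implicit Arguments.
Unset Strict Implicit.
Unset Printing Implicit Defensive.

Import Order.TTheory GRing.Theory Num.Theory.
Local Open Scope ring_scope.

Local Notation emb a := (cls (0, a)).

(** * Partial sums and differences in Chang's group *)

Section ChangGroupOrder.
Local Open Scope mv_scope.
Context {d : Order.disp_t} {A : mvChainType d}.
Implicit Types (m n k : int) (a b c : A) (x y z : chang A).

Lemma oplus_le2r a b c : (a <= b)%O -> (a ⊕ c <= b ⊕ c)%O.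
Proof.
move=> /oplus_le <-; rewrite -oplusA (oplusC (_ ⊙ _) c) oplusA mvleEu oplusA.
by rewrite (oplusC (¬ _)) oplusN oplusul.
Qed.

Lemma odot_le2r a b c : (a <= b)%O -> (a ⊙ c <= b ⊙ c)%O.
Proof. by move=> ab; rewrite /odot mvleN oplus_le2r // mvleN. Qed.

Lemma cls_shift m n a : cls (m, mv0) + cls (n, a) = cls (m + n, a).
Proof.
rewrite cls_add /pair_add /= oplus0l odot0l.
by case: eqP => [->|//]; rewrite cls_ident.
Qed.

Lemma emb_unit : emb mvu = cls (1, mv0) :> chang A.
Proof. by rewrite -cls_ident add0r. Qed.

Lemma cls_unit_muln (n : nat) : cls (1, mv0) *+ n = cls (n%:Z, mv0) :> chang A.
Proof. by elim: n => // n IHn; rewrite mulrS IHn cls_shift. Qed.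

(** The coordinates [(m, a)] thus become an expression in the group, to which
    additive maps can be applied. *)
Lemma cls_decomp m a : cls (m, a) = emb mvu *~ m + emb a.
Proof.
suff -> : emb mvu *~ m = cls (m, mv0) :> chang A by rewrite cls_shift addr0.
rewrite emb_unit; case: m => n; first exact: cls_unit_muln.
rewrite NegzE mulrNz -pmulrn cls_unit_muln cls_opp /pair_opp /=.
by rewrite -/mvu -cls_ident subrK.
Qed.

Lemma chang_gen (P : chang A -> Prop) :
  (forall a, P (emb a)) -> (forall x y, P x -> P y -> P (x - y)) ->
  forall x, P x.
Proof.
move=> Pemb PB.
have P0 : P 0 by apply: Pemb.
have PN x : P x -> P (- x) by rewrite -sub0r; apply: PB.
have PD x y : P x -> P y -> P (x + y).
  by move=> Px Py; rewrite -[y]opprK; apply/PB/PN.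
have Pn (n : nat) : P (emb mvu *+ n).
  by elim: n => // n IHn; rewrite mulrS; apply: PD.
apply: cls_ind => -[m a]; rewrite cls_decomp; apply: PD => //.
by case: m => n; [apply: Pn | rewrite NegzE mulrNz; apply/PN/Pn].
Qed.

(** With [a ⊙ b = 0] the addition of Chang's group carries only if [a ⊕ b = u], and
    then the result [(1, 0)] is identified with [(0, u)]. *)
Lemma emb_oplus a b : a ⊙ b = mv0 -> emb (a ⊕ b) = emb a + emb b.
Proof.
rewrite cls_add /pair_add /= addr0 => ->.
by case: eqP => [->|//]; rewrite emb_unit add0r.
Qed.

Lemma emb_ominus a b : (b <= a)%O -> emb (a ⊖ b) = emb a - emb b.
Proof.
move=> ba; have E : a ⊖ b = a ⊙ ¬ b by rewrite /ominus /odot mvnegK.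
rewrite E; apply/(addIr (emb b)); rewrite subrK -emb_oplus.
  by rewrite oplusC oplus_le.
by rewrite -odotA (odotC _ b) odotN odotC odot0l.
Qed.

(** * Order of Chang's group *)

Lemma chang_triv_eq : (mv0 : A) = mvu -> forall x y, x = y.
Proof. by move=> tr x y; rewrite (cls_triv tr x) (cls_triv tr y). Qed.

(** Second entries equal to [u] are first replaced using [(m, u) = (m + 1, 0)]; this
    can make the integer parts equal, but then the left second entry is [0]. *)
Lemma cls_le_fst m n a b : m < n -> cls (m, a) <= cls (n, b).
Proof.
move=> mn; case: (pselect ((mv0 : A) = mvu)) => [tr|nt].
  by rewrite (chang_triv_eq tr (cls (m, a)) (cls (n, b))).
case: (eqVneq a mvu) => [->|/eqP au]; case: (eqVneq b mvu) => [->|/eqP bu];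
  rewrite -?cls_ident; apply/cls_le => //; try by left; lia.
have [->|mn1] := eqVneq n (m + 1); last by left; lia.
by right; rewrite mvle0.
Qed.

Lemma cls_le_snd m a b : (a <= b)%O -> cls (m, a) <= cls (m, b).
Proof.
move=> ab; case: (eqVneq b mvu) => [->|/eqP bu].
  case: (eqVneq a mvu) => [->//|_].
  by rewrite -cls_ident cls_le_fst // ltrDl.
apply/cls_le => //; last by right.
by move=> au; apply/bu/le_anti; rewrite mvleu -au.
Qed.

(** The second entries may equal [u]: when [A] is trivial there are no others, and
    then [(0, 0)] represents every element.  Translation invariance can thus be
    proved without singling out that case. *)
Lemma le_reps x y : x <= y -> exists m n a b,
  [/\ x = cls (m, a), y = cls (n, b) & m < n \/ m = n /\ (a <= b)%O].
Proof.
case: (pselect ((mv0 : A) = mvu)) => [tr _|nt].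
  exists 0, 0, mv0, mv0; split; [exact: chang_triv_eq..|by right].
have [m [a [au ->]]] := clsP nt x; have [n [b [bu ->]]] := clsP nt y.
by move=> /cls_le xy; exists m, n, a, b; split=> //; apply: xy.
Qed.

Lemma chang_total : total (fun x y : chang A => x <= y).
Proof.
apply: cls_ind => -[m a]; apply: cls_ind => -[n b].
have [/cls_le_fst->//|/cls_le_fst->|->] := ltgtP m n; first exact: orbT.
by case/orP: (le_total a b) => /cls_le_snd->; rewrite ?orbT.
Qed.

Lemma chang_comparable x y : x >=< y.
Proof. exact: chang_total. Qed.

Lemma chang_leD2r x y z : x <= y -> x + z <= y + z.
Proof.
case/le_reps=> m [n [a [b [-> -> mnab]]]]; move: z; apply: cls_ind => -[k c].
rewrite !cls_add /pair_add /=.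
case: (eqVneq (a ⊕ c) mvu) => [ac|_]; case: (eqVneq (b ⊕ c) mvu) => [bc|bc] /=.
- case: mnab => [mn|[-> ab]]; first by apply: cls_le_fst; lia.
  exact/cls_le_snd/odot_le2r.
- case: mnab => [mn|[_ ab]].
    have [->|mn1] := eqVneq n (m + 1); last by apply: cls_le_fst; lia.
    (* The carry on the left only closes the gap between the integer parts. *)
    rewrite addrAC; apply/cls_le_snd/(@le_trans _ _ c).
      by rewrite odotC odot_leL.
    by rewrite -{1}[c]oplus0l oplus_le2r // mvle0.
  by case/eqP: bc; apply/le_anti; rewrite mvleu -ac oplus_le2r.
- by apply: cls_le_fst; case: mnab => [|[]]; lia.
- case: mnab => [mn|[-> ab]]; first by apply: cls_le_fst; lia.
  exact/cls_le_snd/oplus_le2r.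
Qed.

Lemma chang_addr_ge0 x y : 0 <= x -> 0 <= y -> 0 <= x + y.
Proof.
by move=> x0 y0; apply: le_trans y0 _; rewrite -{1}[y]add0r chang_leD2r.
Qed.

Lemma emb_ge0 a : 0 <= emb a.
Proof. exact/cls_le_snd/mvle0. Qed.

(** A positive element has a representative [(n, a)] with [n >= 0], hence is a sum of
    [n] copies of [u] and [emb a]. *)
Lemma chang_nneg_gen (P : chang A -> Prop) :
  (forall a, P (emb a)) -> (forall x y, P x -> P y -> P (x + y)) ->
  forall x, 0 <= x -> P x.
Proof.
move=> Pemb PD x; case: (pselect ((mv0 : A) = mvu)) => [tr _|nt].
  by rewrite (chang_triv_eq tr x 0); apply: Pemb.
have [m [a [au ->]]] := clsP nt x => /(cls_le _ _ nt au) x0.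
have {x0} : 0 <= m by case: x0 => [/ltW|[<-]].
rewrite cls_decomp; case: m => // n _; apply: (PD) => //.
elim: n => [|n IHn]; first exact: Pemb.
by rewrite -pmulrn mulrS; apply: PD.
Qed.

Lemma chang_intervalP x : 0 <= x <= cls (1, mv0) -> exists a, x = emb a.
Proof.
case: (pselect ((mv0 : A) = mvu)) => [tr _|nt].
  by exists mv0; apply: chang_triv_eq.
have [m [a [au ->]]] := clsP nt x.
case/andP=> /(cls_le _ _ nt au) x0 /(cls_le _ _ au nt) [m1|[-> a0]].
  by exists a; congr (cls (_, _)); case: x0 => [|[]]; lia.
have -> : a = mv0 by apply/le_anti; rewrite a0 mvle0.
by exists mvu; rewrite emb_unit.
Qed.

Lemma chang_strong_unit x :
  exists n : nat, Order.max x (- x) <= cls (1, mv0) *+ n.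
Proof.
move: x; apply: cls_ind => -[m a]; exists `|m|.+1%N.
(* [`|m|.+1] exceeds both integer parts, [m] and [- m - 1]. *)
rewrite comparable_ge_max ?chang_comparable // cls_unit_muln cls_opp.
by rewrite !cls_le_fst //=; lia.
Qed.

End ChangGroupOrder.

(** * The product *)

Section SharpProduct.
Local Open Scope mv_scope.
Context {d : Order.disp_t} {A : pmvfChainType d}.
Implicit Types (m n : int) (a b c : A) (x y z : chang A).

(** [a <= b] means [a ⊖ b = 0], and multiplication commutes with [⊖]. *)
Lemma pmul_le2l c a b : (a <= b)%O -> (pmul c a <= pmul c b)%O.
Proof.
rewrite !mvleE => /eqP ab.
by rewrite -/(pmul c a ⊖ pmul c b) -pmul_ominus /ominus ab pmulx0.
Qed.

Lemma emb_pmul_ominus c a b : (b <= a)%O ->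
  emb (pmul c (a ⊖ b)) = emb (pmul c a) - emb (pmul c b).
Proof. by move=> ba; rewrite pmul_ominus emb_ominus // pmul_le2l. Qed.

Lemma emb_pmul_neg c a : emb (pmul c (¬ a)) = emb (pmul c mvu) - emb (pmul c a).
Proof. by rewrite -emb_pmul_ominus ?mvleu // /ominus mvnegu oplus0l. Qed.

(** A sum without carry is turned into a difference by complementing:
    [¬ (a ⊕ b) = ¬ a ⊖ b], with [b <= ¬ a]. *)
Lemma emb_pmul_oplus c a b : a ⊙ b = mv0 ->
  emb (pmul c (a ⊕ b)) = emb (pmul c a) + emb (pmul c b).
Proof.
move=> /eqP; rewrite odotC odot_eq0 => ba.
have -> : a ⊕ b = ¬ (¬ a ⊖ b) by rewrite /ominus !mvnegK.
rewrite emb_pmul_neg emb_pmul_ominus // emb_pmul_neg !opprB.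
by rewrite addrC addrA subrK addrC.
Qed.

(** The carry is absorbed by reading [a ⊙ b] as the genuine difference [a ⊖ ¬ b]. *)
Lemma emb_pmul_odot c a b : a ⊕ b = mvu ->
  emb (pmul c a) + emb (pmul c b) = emb (pmul c mvu) + emb (pmul c (a ⊙ b)).
Proof.
move=> /eqP; rewrite oplusC oplus_equ => ba.
rewrite -[a ⊙ b]/(a ⊖ ¬ b) emb_pmul_ominus // emb_pmul_neg opprB.
by rewrite [RHS]addrC addrA subrK.
Qed.

Lemma sharp_mul_emb_cls c n b : sharp_mul A (emb c) (cls (n, b)) =
  emb (pmul c mvu) *~ n + emb (pmul c b).
Proof. by rewrite sharp_mulE /pair_mul /= mul0r !mulr0z !add0r. Qed.

Lemma sharp_mul_emb a b : sharp_mul A (emb a) (emb b) = emb (pmul a b).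
Proof. by rewrite sharp_mul_emb_cls mulr0z add0r. Qed.

(** Linearity in the first argument along the decomposition [m u + emb a] reduces
    statements about the product to left factors in [[0, u]]. *)
Lemma sharp_mul_cls m a y : sharp_mul A (cls (m, a)) y =
  sharp_mul A (emb mvu) y *~ m + sharp_mul A (emb a) y.
Proof.
move: y; apply: cls_ind => -[n b]; rewrite !sharp_mul_emb_cls sharp_mulE /pair_mul /=.
by rewrite mulrzDl -mulrzA (mulrC n) (pmulC mvu b) !addrA.
Qed.

(** The two cases of the group addition are matched by [emb_pmul_odot] (a carry)
    and [emb_pmul_oplus] (no carry, where totality gives [a ⊙ b = 0]). *)
Lemma sharp_mul_embDr c y z :
  sharp_mul A (emb c) (y + z) = sharp_mul A (emb c) y + sharp_mul A (emb c) z.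
Proof.
move: y z; apply: cls_ind => -[m a]; apply: cls_ind => -[n b].
rewrite cls_add /pair_add /=; case: (eqVneq (a ⊕ b) mvu) => ab /=.
  rewrite !sharp_mul_emb_cls addrACA emb_pmul_odot //.
  by rewrite -mulrzDr [_ *~ (_ + 1)]mulrzDr mulr1z addrA.
rewrite !sharp_mul_emb_cls addrACA -mulrzDr emb_pmul_oplus //.
apply/eqP; rewrite odot_eq0 leNgt; apply: contra ab => /ltW.
by rewrite oplusC oplus_equ.
Qed.

Lemma sharp_mulDr : right_distributive (sharp_mul A) +%R.
Proof.
apply: cls_ind => -[m a] y z.
by rewrite !(sharp_mul_cls m) !sharp_mul_embDr mulrzDl addrACA.
Qed.

Lemma sharp_mulC : commutative (sharp_mul A).
Proof. by move=> x y; rewrite /sharp_mul Defs.pair_mulC. Qed.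

Lemma sharp_mulDl : left_distributive (sharp_mul A) +%R.
Proof. by move=> x y z; rewrite !(sharp_mulC _ z) sharp_mulDr. Qed.

Lemma sharp_mulBr : right_distributive (sharp_mul A) (fun x y => x - y).
Proof.
by move=> x y z; apply: (addIr (sharp_mul A x z)); rewrite -sharp_mulDr !subrK.
Qed.

Lemma sharp_mulBl : left_distributive (sharp_mul A) (fun x y => x - y).
Proof. by move=> x y z; rewrite !(sharp_mulC _ z) sharp_mulBr. Qed.

Lemma sharp_mulA : associative (sharp_mul A).
Proof.
move=> + y z; apply: chang_gen => [a|x1 x2 IH1 IH2]; last first.
  by rewrite !sharp_mulBl IH1 IH2.
move: y; apply: chang_gen => [b|y1 y2 IH1 IH2]; last first.
  by rewrite !(sharp_mulBl, sharp_mulBr) IH1 IH2.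
move: z; apply: chang_gen => [c|z1 z2 IH1 IH2]; last by rewrite !sharp_mulBr IH1 IH2.
by rewrite !sharp_mul_emb pmulA.
Qed.

Lemma sharp_mul_ge0 x y : 0 <= x -> 0 <= y -> 0 <= sharp_mul A x y.
Proof.
move=> + y0; move: x; apply: chang_nneg_gen => [a|x1 x2 IH1 IH2]; last first.
  by rewrite sharp_mulDl chang_addr_ge0.
move: y y0; apply: chang_nneg_gen => [b|y1 y2 IH1 IH2]; last first.
  by rewrite sharp_mulDr chang_addr_ge0.
by rewrite sharp_mul_emb emb_ge0.
Qed.

Lemma sharp_semi_low : semi_low Order.min (sharp_mul A) (sharp_unit A).
Proof.
move=> _ _ /chang_intervalP[a ->] /chang_intervalP[b ->].
rewrite comparable_le_min ?chang_comparable // sharp_mul_emb.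
by have := pmul_le a b; rewrite lexI => /andP[pa pb]; rewrite !cls_le_snd.
Qed.

End SharpProduct.

Theorem theorem5p5 (d : Order.disp_t) (A : pmvfChainType d) :
  [/\ is_lu_ring (R := chang A) Order.min Order.max (sharp_mul A) (sharp_unit A),
      semi_low (R := chang A) Order.min (sharp_mul A) (sharp_unit A)
    & total (fun x y : chang A => x <= y)].
Proof.
split; [split | exact: sharp_semi_low | exact: chang_total].
- exact: chang_leD2r.
- by move=> x y z; rewrite comparable_le_min ?chang_comparable.
- by move=> x y z; rewrite comparable_ge_max ?chang_comparable.
- exact: sharp_mulA.
- exact: sharp_mulC.
- exact: sharp_mulDr.
- exact: sharp_mul_ge0.
- by rewrite sharp_unitE emb_ge0.
- exact: chang_strong_unit.
Qed.
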